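(* Let $f\in\mathcal{F}_L(\mathbb{R}^N)$, let $\mathcal{D}\subseteq\mathcal{S}^{N-1}$ be a $\theta$-cover, let $x(0)\in\mathbb{R}^N$, and let the iterates $x(t)$ be generated by $x(t+1)=x(t)-\gamma(t)d(t)$, $t=0,1,2,\ldots$, where $d(t)\in\mathcal{D}$ satisfies $\mathrm{ang}(\nabla f(x(t)),d(t))\leq\theta$ whenever $\nabla f(x(t))\neq 0$ (and $d(t)\in\mathcal{D}$ is arbitrary otherwise). If the step-sizes $\gamma(t)\geq0$ are chosen so that $\lim_{t\to\infty}\gamma(t)=0$ and $\sum_{t=0}^\infty\gamma(t)=\infty$, then $\lim_{t\to\infty}\mathrm{dist}(x(t),\mathcal{X}^\star)=0$.
   Context: $N\geq 1$, $L>0$, $\|\cdot\|$ is the Euclidean norm, $\mathcal{S}^{N-1}$ is the unit sphere in $\mathbb{R}^N$, and $\mathrm{dist}(x,\mathcal{Y})=\inf_{v\in\mathcal{Y}}\|v-x\|$. For nonzero $u,v\in\mathbb{R}^N$, $\mathrm{ang}(u,v)=\cos^{-1}\big(\langle u,v\rangle/(\|u\|\|v\|)\big)$. Class $\mathcal{F}_L(\mathbb{R}^N)$: the set of functions $f:\mathbb{R}^N\to\mathbb{R}$ that are convex and differentiable with $L$-Lipschitz continuous gradient and whose set of minimizers $\mathcal{X}^\star=\arg\min_{x\in\mathbb{R}^N} f(x)$ is nonempty and bounded. $\theta$-cover: a finite set $\mathcal{D}\subseteq\mathcal{S}^{N-1}$ is a $\theta$-cover if $\theta\in[0,\pi/2)$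 and for all $g\in\mathcal{S}^{N-1}$ there is $d\in\mathcal{D}$ such that $\mathrm{ang}(g,d)\leq\theta$. *)

(* Defs.v *)
From HB Require Import structures.
From mathcomp Require Import all_boot all_order all_algebra.
From mathcomp Require Import all_classical all_reals all_analysis.

Set Implicit Arguments.
Unset Strict Implicit.
Unset Printing Implicit Defensive.

Import Order.TTheory GRing.Theory Num.Theory.
Import numFieldNormedType.Exports.

Local Open Scope classical_set_scope.
Local Open Scope ring_scope.

(* R^N is 'rV[R]_N. The library norm `|x| on 'rV[R]_N is the sup norm, so the
   Euclidean structure is defined here and used wherever a norm occurs
   quantitatively. The library notions [differentiable] and [bounded_set] refer
   to the sup norm, which is harmless: they are invariant under passing to an
   equivalent norm. *)
Definition dotp (R : realType) (N : nat) (u v : 'rV[R]_N) : R :=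
  \sum_(i < N) u 0 i * v 0 i.

Definition enorm (R : realType) (N : nat) (u : 'rV[R]_N) : R :=
  Num.sqrt (dotp u u).

Definition sphere (R : realType) (N : nat) : set 'rV[R]_N :=
  [set u | enorm u = 1].
Arguments sphere : clear implicits.

(* Meaningful for nonzero u and v only. *)
Definition ang (R : realType) (N : nat) (u v : 'rV[R]_N) : R :=
  acos (dotp u v / (enorm u * enorm v)).

(* [inf] is real-valued, hence meaningful only for nonempty Y. *)
Definition dist (R : realType) (N : nat) (x : 'rV[R]_N) (Y : set 'rV[R]_N) : R :=
  inf [set enorm (v - x) | v in Y].

(* delta_mx 0 i : 'rV[R]_N is the i-th vector of the standard basis. *)
Definition grad (R : realType) (N : nat) (f : 'rV[R]_N -> R) (x : 'rV[R]_N) :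
    'rV[R]_N :=
  \row_(i < N) 'D_(delta_mx 0 i) f x.

Definition minimizers (R : realType) (N : nat) (f : 'rV[R]_N -> R) :
    set 'rV[R]_N :=
  [set x | forall y, f x <= f y].

Definition class_F (R : realType) (N : nat) (L : R) : set ('rV[R]_N -> R) :=
  [set f | [/\ convex_function [set: 'rV[R]_N] f,
               forall x, differentiable f x,
               forall x y, enorm (grad f x - grad f y) <= L * enorm (x - y),
               minimizers f !=set0 &
               bounded_set (minimizers f)]].
Arguments class_F [R] N L.

Definition theta_cover (R : realType) (N : nat) (theta : R)
    (D : set 'rV[R]_N) : Prop :=
  [/\ finite_set D,
      D `<=` sphere R N,
      0 <= theta < pi / 2 &
      forall g, sphere R N g -> exists2 d, D d & ang g d <= theta].

(* Main.v *)
Require Import Defs.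
From HB Require Import structures.
From mathcomp Require Import all_boot all_order all_algebra.
From mathcomp Require Import all_classical all_reals all_analysis.
From mathcomp Require Import ring lra.

Set Implicit Arguments.
Unset Strict Implicit.
Unset Printing Implicit Defensive.

Import Order.TTheory GRing.Theory Num.Theory.
Import numFieldNormedType.Exports.

Local Open Scope classical_set_scope.
Local Open Scope ring_scope.

(** The proof follows the gap a(t) = f(x(t)) - min f >= 0.

    One step of the iteration changes the gap by at most
    - gamma c |grad f(x(t))| + L gamma^2 with c = cos theta > 0
    ([smooth_convex_step], [ang_le_dotp]): a direction within theta of the
    gradient still captures the fraction cos theta of its length, and the
    second-order error is quadratic in the step.

    The gradient cannot be small while the gap is large, even far away from the
    minimizers. Around a bounded set of minimizers a convex function grows at
    least linearly outside any neighbourhood of that set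
    ([convex_linear_growth]): compactness gives a positive gap on a sphere
    surrounding the minimizers, and convexity along rays propagates it outwards.
    Since the gap at x is also at most |grad f(x)| |x - p| for a minimizer p,
    dividing by |x - p| yields a uniform lower bound on the gradient over
    a(t) >= e ([grad_lower_bound]), valid however far the iterates travel.

    So a gap of at least e decreases by k gamma(t) - L gamma(t)^2 for some
    k = k(e) > 0. Divergence of the sum of the step sizes forces the gap to
    become small at some time, and gamma(t) -> 0 keeps it small afterwards,
    since a single step cannot raise it by more than L gamma(t)^2
    ([perturbed_descent_cvg0]). Hence the gap tends to 0, and linear growth,
    now away from a thin neighbourhood of the minimizers, turns this into
    convergence of the distance ([dist_cvg0]). *)

(** * Euclidean geometry of row vectors *)

Lemma dotpC (R : realType) (N : nat) (u v : 'rV[R]_N) : dotp u v = dotp v u.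
Proof. by apply: eq_bigr => i _; rewrite mulrC. Qed.

Lemma dotpDl (R : realType) (N : nat) (u v w : 'rV[R]_N) :
  dotp (u + v) w = dotp u w + dotp v w.
Proof. by rewrite -big_split; apply: eq_bigr => i _; rewrite !mxE mulrDl. Qed.

Lemma dotpZl (R : realType) (N : nat) (a : R) (u w : 'rV[R]_N) :
  dotp (a *: u) w = a * dotp u w.
Proof. by rewrite mulr_sumr; apply: eq_bigr => i _; rewrite mxE mulrA. Qed.

Lemma dotpZr (R : realType) (N : nat) (a : R) (u w : 'rV[R]_N) :
  dotp u (a *: w) = a * dotp u w.
Proof. by rewrite dotpC dotpZl dotpC. Qed.

Lemma dotpBl (R : realType) (N : nat) (u v w : 'rV[R]_N) :
  dotp (u - v) w = dotp u w - dotp v w.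
Proof. by rewrite dotpDl -scaleN1r dotpZl mulN1r. Qed.

Lemma dotp_ge0 (R : realType) (N : nat) (u : 'rV[R]_N) : 0 <= dotp u u.
Proof. by apply: sumr_ge0 => i _; rewrite -expr2 sqr_ge0. Qed.

Lemma dotp_eq0 (R : realType) (N : nat) (u : 'rV[R]_N) :
  (dotp u u == 0) = (u == 0).
Proof.
apply/idP/eqP => [|->]; last by rewrite /dotp big1// => i _; rewrite mxE mul0r.
rewrite psumr_eq0 => [/allP u0|i _]; last by rewrite -expr2 sqr_ge0.
apply/rowP => i; rewrite mxE.
by have := u0 i (mem_index_enum i); rewrite mulf_eq0 orbb => /eqP.
Qed.

Lemma enorm_ge0 (R : realType) (N : nat) (u : 'rV[R]_N) : 0 <= enorm u.
Proof. exact: sqrtr_ge0. Qed.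

Lemma sqr_enorm (R : realType) (N : nat) (u : 'rV[R]_N) :
  enorm u ^+ 2 = dotp u u.
Proof. by rewrite sqr_sqrtr ?dotp_ge0. Qed.

Lemma enorm_gt0 (R : realType) (N : nat) (u : 'rV[R]_N) :
  (0 < enorm u) = (u != 0).
Proof. by rewrite sqrtr_gt0 lt_neqAle dotp_ge0 andbT eq_sym dotp_eq0. Qed.

Lemma enormZ (R : realType) (N : nat) (a : R) (u : 'rV[R]_N) :
  enorm (a *: u) = `|a| * enorm u.
Proof.
by rewrite /enorm dotpZl dotpZr mulrA -expr2 sqrtrM ?sqr_ge0// sqrtr_sqr.
Qed.

Lemma CauchySchwarz_dotp (R : realType) (N : nat) (u v : 'rV[R]_N) :
  `|dotp u v| <= enorm u * enorm v.
Proof.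
have [->|u0] := eqVneq u 0.
  by rewrite /dotp big1 ?normr0 ?mulr_ge0 ?enorm_ge0// => i _; rewrite mxE mul0r.
rewrite -ler_sqr ?nnegrE ?mulr_ge0 ?enorm_ge0// real_normK ?num_real//.
rewrite exprMn !sqr_enorm.
have a0 : 0 < dotp u u by rewrite lt_neqAle dotp_ge0 andbT eq_sym dotp_eq0.
(* the squared length of the part of v orthogonal to u, rescaled by <u, u> *)
have := dotp_ge0 (dotp u u *: v - dotp u v *: u).
rewrite dotpBl !dotpZl (dotpC v) (dotpC u (_ - _)) !dotpBl !dotpZl (dotpC v u).
set a := dotp u u in a0 *; set b := dotp u v; set c := dotp v v => h.
have : 0 <= a * (a * c - b ^+ 2) by move: h; congr (0 <= _); ring.
by rewrite pmulr_rge0// subr_ge0.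
Qed.

Lemma ang_le_dotp (R : realType) (N : nat) (theta : R) (u v : 'rV[R]_N) :
  0 <= theta <= pi -> u != 0 -> enorm v = 1 -> ang u v <= theta ->
  cos theta * enorm u <= dotp u v.
Proof.
move=> th u0 v1; rewrite /ang v1 mulr1.
have nu : 0 < enorm u by rewrite enorm_gt0.
set q := dotp u v / enorm u.
have q1 : -1 <= q <= 1.
  rewrite -ler_norml normrM normfV (gtr0_norm nu) ler_pdivrMr// mul1r.
  by have := CauchySchwarz_dotp u v; rewrite v1 mulr1.
move=> qth; rewrite -ler_pdivlMr// -/q -(acosK (x := q)) ?in_itv//.
rewrite leNgt ltr_cos ?in_itv/= ?acos_ge0 ?acos_lepi//.
by rewrite -leNgt.
Qed.

Lemma norm_entry_le (R : realType) (N : nat) (u : 'rV[R]_N) (i : 'I_N) :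
  `|u 0 i| <= `|u|.
Proof.
rewrite [`|u|]mx_normrE.
exact: (le_bigmax _ (fun ij : 'I_1 * 'I_N => `|u ij.1 ij.2|) (0, i)).
Qed.

(** The two norms are compared with the crude factor N instead of the square
    root of N: only the existence of some factor matters. *)
Lemma enorm_le_norm (R : realType) (N : nat) (u : 'rV[R]_N) :
  enorm u <= N%:R * `|u|.
Proof.
rewrite -ler_sqr ?nnegrE ?enorm_ge0 ?mulr_ge0// sqr_enorm.
apply: (@le_trans _ _ (N%:R * `|u| ^+ 2)).
  have -> : N%:R * `|u| ^+ 2 = \sum_(i < N) `|u| ^+ 2.
    by rewrite sumr_const card_ord mulr_natl.
  apply: ler_sum => i _.
  by rewrite -expr2 -(real_normK (num_real _)) ler_sqr ?nnegrE ?norm_entry_le.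
rewrite exprMn ler_wpM2r ?sqr_ge0// -natrX ler_nat.
by case: (N) => // n; rewrite -mulnn leq_pmulr.
Qed.

(** * Descent with vanishing, non-summable steps *)

Lemma series_pinfty_unbounded (R : realType) (g : nat -> R) (n0 : nat) (B : R) :
  (forall t, 0 <= g t) -> (\sum_(0 <= t <oo) (g t)%:E)%E = +oo%E ->
  exists n, B < \sum_(n0 <= t < n0 + n) g t.
Proof.
move=> g0 goo; apply: contrapT => /forallNP gB.
have : (\sum_(0 <= t <oo) (g t)%:E <= (\sum_(0 <= t < n0) g t + B)%:E)%E.
  apply: lime_le; first by apply: is_cvg_nneseries => n _ _; rewrite lee_fin.
  near=> n; rewrite sumEFin lee_fin.
  have n0n : (n0 <= n)%N by near: n; exact: nbhs_infty_ge.
  rewrite (@big_cat_nat _ _ _ n0)//= lerD2l leNgt.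
  by have := gB (n - n0)%N; rewrite subnKC// => /negP.
by rewrite goo leye_eq.
Unshelve. all: by end_near.
Qed.

(** Once the steps are small, the term [k * g t] dominates the error twice over
    above the threshold e / 2, so a decreases there by at least a multiple of
    [g t]; since the [g t] are not summable, a must fall below e / 2 at some
    time. From then on it stays below e: a step starting under e / 2 adds at
    most e / 2, a step starting between e / 2 and e goes down. *)
Lemma perturbed_descent_cvg0 (R : realType) (a g : nat -> R) (C : R) :
  0 <= C -> (forall t, 0 <= a t) -> (forall t, 0 <= g t) ->
  g t @[t --> \oo] --> 0 -> (\sum_(0 <= t <oo) (g t)%:E)%E = +oo%E ->
  (forall t, a t.+1 <= a t + C * g t ^+ 2) ->
  (forall e, 0 < e -> exists2 k, 0 < k &
    forall t, e <= a t -> a t.+1 <= a t - k * g t + C * g t ^+ 2) ->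
  a t @[t --> \oo] --> 0.
Proof.
move=> C0 a0 g0 gcvg gsum astep adesc; apply/cvgr0Pnorm_lt => e e0.
have e20 : 0 < e / 2 by rewrite divr_gt0.
have [k k0 ak] := adesc _ e20.
have C10 : 0 < C + 1 by rewrite ltr_wpDl.
(* the cap by 1 gives g t ^+ 2 <= g t, so one bound on C * g t serves for both
   conclusions of [small] *)
pose eta := Num.min 1 (Num.min (k / 2) (e / 2) / (C + 1)).
have eta0 : 0 < eta by rewrite lt_min ltr01 divr_gt0// lt_min e20 divr_gt0.
have /cvgr0Pnorm_lt/(_ _ eta0)[n0 _ n0P] := gcvg.
have small t : (n0 <= t)%N -> C * g t <= k / 2 /\ C * g t ^+ 2 <= e / 2.
  move=> /n0P /=; rewrite ger0_norm// lt_min => /andP[g1].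
  rewrite ltr_pdivlMr// lt_min => /andP[gk ge].
  have := g0 t => gt0.
  have h1 : g t ^+ 2 <= g t by rewrite expr2 ler_piMl// ltW.
  have h2 : C * g t ^+ 2 <= C * g t by rewrite ler_wpM2l.
  have : g t * (C + 1) = C * g t + g t by ring.
  by split; lra.
have decr t : (n0 <= t)%N -> e / 2 <= a t -> a t.+1 <= a t - k / 2 * g t.
  move=> /small[gk _] /ak /le_trans; apply.
  have : C * g t ^+ 2 <= k / 2 * g t by rewrite expr2 mulrA ler_wpM2r.
  lra.
have [T n0T aT] : exists2 T, (n0 <= T)%N & a T < e / 2.
  apply: contrapT => /forall2NP noT.
  have big t : (n0 <= t)%N -> e / 2 <= a t.
    by move=> n0t; have [//|/negP] := noT t; rewrite leNgt.
  have sumle n : a (n0 + n)%N <= a n0 - k / 2 * \sum_(n0 <= t < n0 + n) g t.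
    elim: n => [|n IH]; first by rewrite addn0 big_geq// mulr0 subr0.
    rewrite addnS big_nat_recr ?leq_addr//=.
    have n0n := leq_addr n n0.
    have := decr _ n0n (big _ n0n); lra.
  have [n] := series_pinfty_unbounded n0 (2 * a n0 / k) g0 gsum.
  rewrite ltr_pdivrMr// => hn.
  have := a0 (n0 + n)%N; have := sumle n; lra.
exists T => // t /= Tt; rewrite ger0_norm//.
elim: t Tt => [|t IH]; first by rewrite leqn0 => /eqP <-; lra.
rewrite leq_eqVlt => /predU1P[<-|]; first lra.
rewrite ltnS => Tt; have n0t := leq_trans n0T Tt.
have [at_lt|at_ge] := ltP (a t) (e / 2).
  by have [_] := small _ n0t; have := astep t; lra.
have : 0 <= k / 2 * g t by rewrite mulr_ge0// divr_ge0// ltW.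
have := decr _ n0t at_ge; have := IH Tt; lra.
Qed.

(** * Differentiable convex functions *)

Lemma dotp_grad (R : realType) (N : nat) (f : 'rV[R]_N -> R) (x v : 'rV[R]_N) :
  differentiable f x -> 'D_v f x = dotp (grad f x) v.
Proof.
move=> df; rewrite deriveE// [v in LHS]row_sum_delta linear_sum.
by apply: eq_bigr => i _; rewrite linearZ /= mxE deriveE// mulrC.
Qed.

(** The form of convexity used along a segment starting at x; the library puts
    the weight t on the first of the two points. *)
Lemma convex_le_segment (R : realType) (N : nat) (f : 'rV[R]_N -> R) :
  convex_function [set: 'rV[R]_N] f -> forall (t : R) x y, 0 <= t <= 1 ->
  f (x + t *: (y - x)) <= f x + t * (f y - f x).
Proof.
move=> cf t x y /andP[t0 t1].
have := cf (Itv01 t0 t1) y x (in_setT _) (in_setT _).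
rewrite convRE /=.
have -> : conv (Itv01 t0 t1) (y : convex_lmodType 'rV[R]_N) x =
    x + t *: (y - x).
  by apply/rowP => i; rewrite !mxE /unstable.onem /=; ring.
rewrite /unstable.onem; lra.
Qed.

(** By convexity the difference quotients of f at x in the direction y - x are
    at most f y - f x for steps in ]0, 1]; let the step tend to 0. *)
Lemma convex_ge_tangent (R : realType) (N : nat) (f : 'rV[R]_N -> R)
    (x y : 'rV[R]_N) :
  convex_function [set: 'rV[R]_N] f -> differentiable f x ->
  f x + dotp (grad f x) (y - x) <= f y.
Proof.
move=> cf df; rewrite -lerBrDl -dotp_grad//.
have /cvg_dnbhs_at_right dc := diff_derivable (v := y - x) df.
rewrite /derive -(cvg_lim _ dc)//.
apply: limr_le; first by apply: cvgP dc.
near=> h.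
have h0 : 0 < h by near: h; exact: nbhs_right_gt.
have h1 : h <= 1 by near: h; exact: nbhs_right_le.
rewrite /= [_ *: _]mulrC ler_pdivrMr//.
have := convex_le_segment cf x y (t := h).
rewrite ltW//= h1 => /(_ isT); rewrite addrC; lra.
Unshelve. all: by end_near.
Qed.

(** Convexity replaces the integral of the gradient along the step: the tangent
    inequality is taken at the arrival point y, and the gradient at y differs
    from the one at x by at most L |x - y|. The price is the constant L in front
    of the quadratic term, where integration would give L / 2. *)
Lemma smooth_convex_step (R : realType) (N : nat) (L : R) (f : 'rV[R]_N -> R)
    (x d : 'rV[R]_N) (g : R) :
  convex_function [set: 'rV[R]_N] f -> (forall z, differentiable f z) ->
  (forall y z, enorm (grad f y - grad f z) <= L * enorm (y - z)) ->
  f (x - g *: d) <= f x - g * dotp (grad f x) d + L * (g * enorm d) ^+ 2.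
Proof.
move=> cf df lf; set y := x - g *: d.
have tan := convex_ge_tangent x cf (df y).
have xy : x - y = g *: d by rewrite /y opprB addrCA subrr addr0.
rewrite xy dotpZr in tan.
have cs := CauchySchwarz_dotp (grad f x - grad f y) (g *: d).
have := lf x y; rewrite xy => /(ler_wpM2r (enorm_ge0 (g *: d))).
rewrite -mulrA -expr2 [enorm (g *: d) ^+ 2]sqr_enorm dotpZl dotpZr.
rewrite -(sqr_enorm d) => lip.
have := le_trans (le_trans (ler_norm _) cs) lip.
rewrite dotpZr dotpBl exprMn; lra.
Qed.

(** * Growth away from the minimizers *)

(** Let B be the radius of a ball around p containing all minimizers in its
    interior. On the part K of the closed ball lying outside A or on the
    boundary sphere, f - f p has a positive minimum m by compactness. A point
    outside the ball is joined to p by a segment crossing the sphere, hence K,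
    at the fraction t = B / |x - p|, and convexity gives m <= t (f x - f p). *)
Lemma convex_linear_growth (R : realType) (N : nat) (f : 'rV[R]_N -> R)
    (p : 'rV[R]_N) (A : set 'rV[R]_N) :
  convex_function [set: 'rV[R]_N] f -> continuous f ->
  bounded_set (minimizers f) -> minimizers f p ->
  open A -> minimizers f `<=` A ->
  exists2 c, 0 < c & forall x, ~ A x -> c * `|x - p| <= f x - f p.
Proof.
move=> cf contf bf pmin Ao minA.
have [M Mb] : exists M, forall v, minimizers f v -> `|v| <= M.
  by case: bf => M [_ Mb]; exists (M + 1) => v; apply: Mb; rewrite ltrDl.
have M0 : 0 <= M by rewrite (le_trans _ (Mb p pmin)).
pose B := 2 * M + 1; have B0 : 0 < B by rewrite /B; lra.
have minB v : minimizers f v -> `|v - p| < B.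
  move=> /Mb vM; rewrite (le_lt_trans (ler_normB _ _))//.
  by have := Mb p pmin; rewrite /B; lra.
pose K := [set y | `|y - p| <= B] `\` (A `&` [set y | `|y - p| < B]).
have normc : continuous (fun y : 'rV[R]_N => `|y - p|).
  move=> y; apply: (@continuous_comp _ _ _ (fun z : 'rV[R]_N => z - p)
    (fun z : 'rV[R]_N => `|z|)).
    by apply: continuousB; [exact: cvg_id|exact: cst_continuous].
  exact: norm_continuous.
have Kc : compact K.
  apply: bounded_closed_compact.
    exists (B + `|p|); split=> [|z /ltW zB y [/= yB _]]; first exact: num_real.
    apply: le_trans zB.
    by rewrite -[y](subrK p) (le_trans (ler_normD _ _))// lerD2r.
  apply: closedI.
    exact: (preimage_closed (fun y _ => normc y) (@closed_le _ B)).
  apply: open_closedC; apply: openI => //.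
  exact: (open_comp (fun y _ => normc y) (@open_lt _ B)).
have [m m0 mK] : exists2 m, 0 < m & forall y, K y -> m <= f y - f p.
  have [K0|/nonemptyPn K0] := pselect (K !=set0); last first.
    by exists 1 => // y; rewrite K0.
  have [|k kK kmin] := EVT_min_rV K0 Kc (f := f).
    exact: continuous_subspaceT.
  rewrite inE in kK.
  exists (f k - f p) => [|y yK]; last by rewrite lerD2r kmin ?inE.
  rewrite subr_gt0 ltNge; apply/negP => fkp; case: kK => _; apply.
  have kM : minimizers f k by move=> z; exact: le_trans fkp (pmin z).
  by split; [exact: minA|exact: minB].
exists (m / B) => [|x Ax]; first exact: divr_gt0.
have [xB|xB] := leP `|x - p| B.
  apply: (@le_trans _ _ m); last by apply: mK; split=> // -[].
  by rewrite mulrAC ler_pdivrMr// ler_pM2l.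
have n0 : 0 < `|x - p| by exact: lt_trans xB.
pose t := B / `|x - p|.
have t0 : 0 < t by rewrite divr_gt0.
have t1 : t <= 1 by rewrite ler_pdivrMr// mul1r ltW.
pose y := p + t *: (x - p).
have yB : `|y - p| = B.
  by rewrite /y addrC addKr normrZ gtr0_norm// /t divfK// gt_eqF.
have yK : K y by split; rewrite /= yB ?lexx// => -[_]; rewrite ltxx.
have := convex_le_segment cf p x (t := t).
rewrite (ltW t0) t1 => /(_ isT); rewrite -/y => fy.
rewrite mulrAC -mulrA -[_ / B]invf_div -/t ler_pdivrMr//.
by have := mK _ yK; lra.
Qed.

(** Above the level f p + e the gap is at least c |x - p| by linear growth, and
    at most <grad f x, x - p> by convexity. The growth is measured in the sup
    norm and the inner product in the Euclidean one, whence the factor N. *)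
Lemma grad_lower_bound (R : realType) (N : nat) (f : 'rV[R]_N -> R)
    (p : 'rV[R]_N) (e : R) :
  (0 < N)%N -> convex_function [set: 'rV[R]_N] f ->
  (forall x, differentiable f x) ->
  bounded_set (minimizers f) -> minimizers f p -> 0 < e ->
  exists2 k, 0 < k & forall x, e <= f x - f p -> k <= enorm (grad f x).
Proof.
move=> N0 cf df bf pmin e0.
have contf : continuous f by move=> x; exact: differentiable_continuous.
have [|v vmin|c c0 growth] := convex_linear_growth
    (A := [set x | f x < f p + e]) cf contf bf pmin.
- exact: (open_comp (fun y _ => contf y) (@open_lt _ _)).
- by rewrite /= (le_lt_trans (vmin p))// ltrDl.
exists (c / N%:R) => [|x ex]; first by rewrite divr_gt0// ltr0n.
have xp : 0 < `|x - p|.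
  rewrite normr_gt0 subr_eq0; apply: contraTneq ex => ->.
  by rewrite subrr -ltNge.
have /growth cx : ~ (f x < f p + e) by apply/negP; rewrite -leNgt; lra.
rewrite ler_pdivrMr ?ltr0n// -(ler_pM2r xp) (le_trans cx)//.
have := convex_ge_tangent p cf (df x).
have := lerNnormlW (CauchySchwarz_dotp (grad f x) (p - x)).
have := ler_wpM2l (enorm_ge0 (grad f x)) (enorm_le_norm (p - x)).
rewrite distrC -mulrA; lra.
Qed.

(** If the gap is below c r, linear growth outside the union A of the balls of
    radius r around the minimizers forces the iterate into A, because the points
    outside A are at distance at least r from the minimizer p. *)
Lemma dist_cvg0 (R : realType) (N : nat) (f : 'rV[R]_N -> R)
    (p : 'rV[R]_N) (x : nat -> 'rV[R]_N) :
  convex_function [set: 'rV[R]_N] f -> continuous f ->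
  bounded_set (minimizers f) -> minimizers f p ->
  f (x t) - f p @[t --> \oo] --> 0 ->
  dist (x t) (minimizers f) @[t --> \oo] --> 0.
Proof.
move=> cf contf bf pmin fx; apply/cvgr0Pnorm_lt => e e0.
(* the successor makes the final comparison strict and avoids dividing by 0 *)
pose r := e / N.+1%:R; have r0 : 0 < r by rewrite divr_gt0.
have dist_lb y : lbound [set enorm (v - y) | v in minimizers f] 0.
  by move=> _ [v _ <-]; exact: enorm_ge0.
have [|v vmin|c c0 growth] := convex_linear_growth
    (A := \bigcup_(v in minimizers f) ball v r) cf contf bf pmin.
- by apply: bigcup_open => v _; exact: ball_open.
- by exists v => //; exact: ballxx.
have cr0 : 0 < c * r by rewrite mulr_gt0.
have /cvgr0Pnorm_lt/(_ _ cr0) := fx.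
apply: filterS => t fxt.
rewrite ger0_norm; last first.
  by apply: lb_le_inf => //; exists (enorm (p - x t)), p.
have [v vmin vx] : (\bigcup_(v in minimizers f) ball v r) (x t).
  apply: contrapT => nA; have := growth _ nA; apply/negP; rewrite -ltNge.
  apply: (le_lt_trans (ler_norm _)); apply: (lt_le_trans fxt).
  rewrite ler_pM2l// leNgt; apply/negP => xp; apply: nA; exists p => //.
  by rewrite -ball_normE /= distrC.
apply: (@le_lt_trans _ _ (enorm (v - x t))).
  by apply: ge_inf; [exists 0; exact: dist_lb|exists v].
apply: (le_lt_trans (enorm_le_norm _)).
move: vx; rewrite -ball_normE /= => vx.
apply: (@le_lt_trans _ _ (N%:R * r)); first by rewrite ler_wpM2l// ltW.
by rewrite /r mulrCA gtr_pMr// ltr_pdivrMr ?ltr0n// mul1r ltr_nat.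
Qed.

(** * Convergence of the iterates *)

Theorem theorem8 (R : realType) (N : nat) (hN : (1 <= N)%N)
    (L : R) (hL : 0 < L)
    (f : 'rV[R]_N -> R) (hf : class_F N L f)
    (theta : R) (D : set 'rV[R]_N) (hD : theta_cover theta D)
    (x d : nat -> 'rV[R]_N) (gamma : nat -> R)
    (hx : forall t, x t.+1 = x t - gamma t *: d t)
    (hdD : forall t, D (d t))
    (hdang : forall t, grad f (x t) != 0 -> ang (grad f (x t)) (d t) <= theta)
    (hgamma_ge0 : forall t, 0 <= gamma t)
    (hgamma_lim : gamma t @[t --> \oo] --> 0)
    (hgamma_sum : (\sum_(0 <= t <oo) (gamma t)%:E)%E = +oo%E) :
  dist (x t) (minimizers f) @[t --> \oo] --> 0.
Proof.
have [cf df lf [p pmin] bf] := hf.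
have [_ Dsphere /andP[th0 th1] _] := hD.
have d1 t : enorm (d t) = 1 by exact: Dsphere.
have contf : continuous f by move=> z; exact: differentiable_continuous.
have pi0 := pi_gt0 R.
have cos0 : 0 < cos theta.
  by apply: cos_gt0_pihalf; rewrite th1 andbT; lra.
have descent t : cos theta * enorm (grad f (x t)) <= dotp (grad f (x t)) (d t).
  have [->|g0] := eqVneq (grad f (x t)) 0.
    by rewrite -(scale0r 0) enormZ dotpZl normr0 !mul0r mulr0.
  by apply: ang_le_dotp (hdang _ g0) => //; rewrite th0/=; lra.
have step t : f (x t.+1) - f p <= f (x t) - f p
    - gamma t * (cos theta * enorm (grad f (x t))) + L * gamma t ^+ 2.
  have := smooth_convex_step (x t) (d t) (gamma t) cf df lf.
  rewrite -hx d1 mulr1.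
  by have := ler_wpM2l (hgamma_ge0 t) (descent t); lra.
apply: (dist_cvg0 cf contf bf pmin).
apply: (perturbed_descent_cvg0 (C := L) (ltW hL) _ hgamma_ge0) => //.
- by move=> t; rewrite subr_ge0.
- move=> t; have : 0 <= gamma t * (cos theta * enorm (grad f (x t))).
    by rewrite !mulr_ge0 ?enorm_ge0// ltW.
  by have := step t; lra.
move=> e e0; have [k k0 gradk] := grad_lower_bound hN cf df bf pmin e0.
exists (cos theta * k) => [|t et]; first exact: mulr_gt0.
have := ler_wpM2l (ltW cos0) (gradk _ et) => /(ler_wpM2l (hgamma_ge0 t)).
by have := step t; lra.
Qed.
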